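(* Let $c>0$ and $\beta\in(0,2)$, and let $k$ be the power type kernel $k(j)=\frac{c}{|j|^{1+\beta}}$ for $j\in\mathbb{Z}\setminus\{0\}$, $k(0)=0$. There exists no finite $d>0$ such that $$\Gamma_2(v)(0)\ge\frac1d\big(\mathcal{L}v(0)\big)^2$$ holds for all compactly supported functions $v:\mathbb{Z}\to\mathbb{R}$.
   Context: For the kernel $k$ and $u:\mathbb{Z}\to\mathbb{R}$ one sets $\mathcal{L}u(x)=\sum_{j\in\mathbb{Z}}k(j)\big(u(x+j)-u(x)\big)$ and $\Gamma_2(u)(x)=\frac14\sum_{j,l\in\mathbb{Z}}k(j)k(l)\big(u(x+j+l)-u(x+j)-u(x+l)+u(x)\big)^2$, $x\in\mathbb{Z}$. Compactly supported means nonzero at only finitely many points of $\mathbb{Z}$. *)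

(* Defs.v *)
From mathcomp Require Import all_boot all_order all_algebra.
From mathcomp Require Import boolp classical_sets functions cardinality reals.
From mathcomp Require Import ereal esum numfun exp.

Set Implicit Arguments.
Unset Strict Implicit.
Unset Printing Implicit Defensive.

Import Order.TTheory GRing.Theory Num.Theory.

Local Open Scope classical_set_scope.
Local Open Scope ring_scope.

Definition power_kernel (R : realType) (c beta : R) (j : int) : R :=
  if j == 0 then 0 else c / (`|j%:~R| `^ (1 + beta)).

(* [esum] is a supremum of finite partial sums, hence only meaningful for
   nonnegative terms; an (absolutely convergent) sum of signed terms is the
   difference of the sums of its positive and negative parts.  Values are kept
   in [\bar R], so that no divergent sum is silently replaced by a real. *)
Definition zsum (R : realType) (f : int -> R) : \bar R :=
  (\esum_(j in [set: int]) (f^\+ j)%:E - \esum_(j in [set: int]) (f^\- j)%:E)%E.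

Definition Lop (R : realType) (k u : int -> R) (x : int) : \bar R :=
  zsum (fun j => k j * (u (x + j) - u x)).

Definition Gamma2 (R : realType) (k u : int -> R) (x : int) : \bar R :=
  ((4^-1)%:E * \esum_(p in [set: int * int])
     (k p.1 * k p.2 *
      (u (x + p.1 + p.2) - u (x + p.1) - u (x + p.2) + u x) ^+ 2)%:E)%E.

Definition compactly_supported (R : realType) (v : int -> R) : Prop :=
  finite_set [set x | v x != 0].

(* Main.v *)
Require Import Defs.
From mathcomp Require Import all_boot all_order all_algebra.
From mathcomp Require Import boolp classical_sets cardinality fsbigop.
From mathcomp Require Import reals ereal normedtype sequences esum.
From mathcomp Require Import numfun exp.
From mathcomp Require Import zify ring lra.

(** Write [w x = (min |x| N)^beta] and test the inequality with
    [v = w - N^beta], which has compact support and the same differences as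
    [w].  On the range [|j| <= N] the terms of [L w (0)] are [c / |j|], so
    [A = L w (0)] is at least [c] times the [N]-th harmonic number and is
    unbounded in [N], although each [A] is finite.  On the other hand
    [Gamma2 w (0) <= C A] with [C] independent of [N]: at the critical exponent
    [beta] both sides gain the same amount from every scale.  The supposed
    inequality would give [A^2 / d <= C A], that is [A <= C d] for all [N].

    The bound on [Gamma2] goes as follows.  Fix [0 < delta <= beta] with
    [beta + delta <= 2].  If [a = |l| <= b = |j|] and [M = min b N], then the
    second difference of [w] squared is at most
    [81 M^(beta - delta) (min a M)^(beta + delta)] ([trunc_pow_diff2]); this
    rests on the Hoelder estimate
    [s^beta - t^beta <= 2 s^(beta - theta) (s - t)^theta] ([powR_holder]) with
    [theta = (beta + delta) / 2], which exceeds neither [1] nor [beta], and on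
    [min _ N] being 1-Lipschitz.  As [2 theta > beta], summing over all [a]
    against the kernel costs only a constant times [M^delta]
    ([sum_powR_minn_le]), and the product of the two powers is [M^beta = w j]:
    what remains is the sum of [k j * w j], which is [A].  Admissible [delta]
    exist exactly because [0 < beta < 2]; the proof uses
    [delta = min(beta, 2 - beta)]. *)

Set Implicit Arguments.
Unset Strict Implicit.
Unset Printing Implicit Defensive.

Import Order.TTheory GRing.Theory Num.Theory.

Local Open Scope ring_scope.

(** * Power sums and the truncated power *)

Section RealPowers.
Variable R : realType.
Implicit Types (beta delta theta s t : R) (n K M N : nat).

(** Writing [n = (n + 1) (1 - 1 / (n + 1))] turns the discrete increments of
    [n^r], for either sign of [r], into elementary bounds on the exponential. *)
Lemma powR_natS n r : (0 < n)%N ->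
  (n%:R : R) `^ r = n.+1%:R `^ r * expR (r * ln (1 - n.+1%:R^-1)).
Proof.
move=> n0; have hn : (0 : R) < n.+1%:R by rewrite ltr0n.
have e : (n%:R : R) = n.+1%:R * (1 - n.+1%:R^-1).
  by rewrite mulrBr mulr1 divff ?lt0r_neq0// -natr1 addrK.
have x0 : (0 : R) < 1 - n.+1%:R^-1.
  by rewrite subr_gt0 invf_lt1// ltr1n.
rewrite {1}e powRM ?(ltW x0)// ?(ltW hn)//; congr (_ * _).
by rewrite /powR (gt_eqF x0).
Qed.

Lemma ln_1Binv_le n : (0 < n)%N -> ln (1 - n.+1%:R^-1) <= - n.+1%:R^-1 :> R.
Proof.
move=> n0; apply: le_ln1Dx.
by rewrite ltrN2 invf_lt1 ?ltr1n// ltr0n.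
Qed.

(** Telescoping this bounds the sum of [n^(delta - 1)] over [1 <= n <= M] by
    [2 / delta * M^delta].  It follows from [exp (- y) <= 1 - y / 2] for
    [y = delta / (n + 1) <= 1], a consequence of [exp y >= 1 + y]. *)
Lemma powR_increment delta n : 0 < delta <= 1 ->
  delta / 2 * n.+1%:R `^ (delta - 1) <= n.+1%:R `^ delta - n%:R `^ delta :> R.
Proof.
move=> /andP[d0 d1]; case: n => [|n].
  rewrite powR0 ?lt0r_neq0// subr0 !powR1; lra.
set m := n.+1; have m0 : (0 < m)%N by [].
have hm : (0 : R) < m.+1%:R by rewrite ltr0n.
have e : m.+1%:R `^ (delta - 1) = m.+1%:R `^ delta * m.+1%:R^-1 :> R.
  by rewrite powRB ?(gt_eqF hm) ?implybT// powRr1// ltW.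
rewrite e (powR_natS _ m0) -[X in X - _]mulr1 -mulrBr mulrCA.
rewrite ler_pM2l ?powR_gt0//.
set x : R := m.+1%:R^-1.
have x0 : 0 < x by rewrite invr_gt0.
have x1 : x <= 1 by rewrite invf_le1 ?ler1n.
have h1 : expR (delta * ln (1 - x)) <= expR (- (delta * x)).
  by rewrite ler_expR -mulrN ler_pM2l//; exact: ln_1Binv_le.
have h2 := expR_ge1Dx (delta * x).
set y := delta * x in h1 h2 *.
have y0 : 0 < y by rewrite mulr_gt0.
have y1 : y <= 1 by rewrite mulr_ile1// ltW.
have h3 : expR (- y) * expR y = 1 by rewrite -expRD addNr expR0.
have h4 := expR_gt0 (- y).
have : delta / 2 * x = y / 2 by rewrite /y; ring.
move=> ->.
have h5 : expR (- y) * (1 + y) <= 1 by rewrite -[leRHS]h3 ler_pM2l.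
have h6 : expR (- y) * (1 + y) <= (1 - y / 2) * (1 + y) by nra.
rewrite ler_pM2r in h6; lra.
Qed.

(** Telescoping this bounds the tail sum of [n^(- (1 + beta))] over [n > M] by
    [M^(- beta) / beta]. *)
Lemma powRN_decrement beta n : 0 < beta -> (0 < n)%N ->
  beta * n.+1%:R `^ (- (1 + beta)) <= n%:R `^ (- beta) - n.+1%:R `^ (- beta) :> R.
Proof.
move=> b0 n0.
have hm : (0 : R) < n.+1%:R by rewrite ltr0n.
have e : n.+1%:R `^ (- (1 + beta)) = n.+1%:R `^ (- beta) * n.+1%:R^-1 :> R.
  by rewrite opprD addrC powRB ?(gt_eqF hm) ?implybT// powRr1// ltW.
rewrite e (powR_natS _ n0) -[X in _ - X]mulr1 -mulrBr mulrCA.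
rewrite ler_pM2l ?powR_gt0//.
have h1 : beta * n.+1%:R^-1 <= - beta * ln (1 - n.+1%:R^-1).
  by rewrite mulNr -mulrN ler_pM2l// lerNr ln_1Binv_le.
have := expR_ge1Dx (- beta * ln (1 - n.+1%:R^-1)).
move: h1; set y := - beta * _; set x := beta / _ => h1 h2.
lra.
Qed.

(** The sum lives at the scale [n ~ M]: below [M] the summand is
    [n^(delta - 1)] with [delta > 0], above it is
    [M^(beta + delta) n^(- (1 + beta))], and both parts are of order [M^delta].
    Each part is an induction on [K] whose bound telescopes. *)
Lemma sum_powR_minn_le beta delta K M : 0 < beta -> 0 < delta <= 1 ->
  \sum_(n < K.+1) n%:R `^ (- (1 + beta)) * (minn n M)%:R `^ (beta + delta)
   <= (2 / delta + beta^-1) * M%:R `^ delta.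
Proof.
move=> b0 hd; have /andP[d0 d1] := hd.
have bd0 : beta + delta != 0 by rewrite lt0r_neq0 ?addr_gt0.
pose T K := \sum_(n < K.+1) n%:R `^ (- (1 + beta)) * (minn n M)%:R `^ (beta + delta).
have TS k : T k.+1 = T k + k.+1%:R `^ (- (1 + beta)) * (minn k.+1 M)%:R `^ (beta + delta).
  by rewrite /T big_ord_recr.
have T0 : T 0%N = 0.
  by rewrite /T big_ord_recr big_ord0 /= min0n (powR0 bd0) mulr0 addr0.
have c0 : 0 < 2 / delta + beta^-1 by rewrite addr_gt0 ?divr_gt0 ?invr_gt0.
have head k : (k <= M)%N -> T k <= 2 / delta * k%:R `^ delta.
  elim: k => [_|k IH kM]; first by rewrite T0 powR0 ?lt0r_neq0// mulr0.
  rewrite TS (minn_idPl kM) -powRD; last by rewrite pnatr_eq0 implybT.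
  have -> : - (1 + beta) + (beta + delta) = delta - 1 by ring.
  have := powR_increment k hd; have := IH (ltnW kM).
  set a := k.+1%:R `^ (delta - 1).
  have ea : a = 2 / delta * (delta / 2 * a) by field; rewrite lt0r_neq0.
  rewrite [in X in _ -> _ -> X]ea; set b := delta / 2 * a => h1 h2.
  have h3 : 2 / delta * b <= 2 / delta * (k.+1%:R `^ delta - k%:R `^ delta).
    by rewrite ler_pM2l// divr_gt0.
  rewrite mulrBr in h3; lra.
case: (posnP M) => [M0|M0].
  rewrite -/(T K) M0 powR0 ?lt0r_neq0// mulr0.
  rewrite /T big1// => i _; by rewrite M0 minn0 (powR0 bd0) mulr0.
have hM : (0 : R) < M%:R by rewrite ltr0n.
have tail k : T (M + k)%N <= 2 / delta * M%:R `^ delta +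
    beta^-1 * M%:R `^ (beta + delta) * (M%:R `^ (- beta) - (M + k)%:R `^ (- beta)).
  elim: k => [|k IH]; first by rewrite addn0 subrr mulr0 addr0 head.
  rewrite addnS TS (minn_idPr _) ?(leq_trans (leq_addr k M))//.
  have Mk : (0 < M + k)%N by rewrite addn_gt0 M0.
  have := powRN_decrement b0 Mk.
  set a := _ `^ (- (1 + beta)); set x := _ `^ (- beta); set y := _ `^ (- beta).
  set z := _ `^ (beta + delta) => h1.
  have z0 : 0 <= z by exact: powR_ge0.
  have h2 : beta^-1 * z * (beta * a) <= beta^-1 * z * (x - y).
    by rewrite ler_wpM2l// mulr_ge0// invr_ge0 ltW.
  have e : beta^-1 * z * (beta * a) = a * z by field; rewrite lt0r_neq0.
  rewrite e in h2; move: IH; rewrite -/x -/z; rewrite !mulrBr in h2 *; lra.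
have tM : T (M + K)%N <= (2 / delta + beta^-1) * M%:R `^ delta.
  apply: (le_trans (tail K)); rewrite [leRHS]mulrDl lerD2l -mulrA ler_pM2l ?invr_gt0//.
  rewrite mulrBr -powRD ?lt0r_neq0 ?implybT// addrAC subrr add0r.
  by rewrite gerBl mulr_ge0 ?powR_ge0.
apply: le_trans tM; rewrite -/(T K) addnC.
have Tm k : T K <= T (K + k)%N.
  elim: k => [|k IH]; first by rewrite addn0.
  by rewrite addnS TS (le_trans IH)// lerDl mulr_ge0 ?powR_ge0.
exact: Tm.
Qed.

(** By homogeneity put [t = s r]; then
    [1 - r^beta <= 1 - r^2 <= 2 (1 - r) <= 2 (1 - r)^theta]. *)
Lemma powR_holder beta theta s t : 0 < theta <= 1 -> theta <= beta <= 2 ->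
  0 <= t <= s -> s `^ beta - t `^ beta <= 2 * s `^ (beta - theta) * (s - t) `^ theta.
Proof.
move=> /andP[h0 h1] /andP[hb b2] /andP[t0 ts].
have b0 : 0 < beta by lra.
have [s0|s0] := eqVneq s 0.
  have -> : t = 0 by lra.
  by rewrite s0 powR0 ?lt0r_neq0// subrr mulr_ge0 ?mulr_ge0 ?powR_ge0.
have {}s0 : 0 < s by rewrite lt0r s0 (le_trans t0 ts).
pose r := t / s.
have r0 : 0 <= r by rewrite divr_ge0// ltW.
have r1 : r <= 1 by rewrite ler_pdivrMr// mul1r.
have -> : t = s * r by rewrite /r mulrC divfK// lt0r_neq0.
have q0 : 0 <= 1 - r by rewrite subr_ge0.
have -> : s - s * r = s * (1 - r) by rewrite mulrBr mulr1.
rewrite (powRM _ (ltW s0) r0) (powRM _ (ltW s0) q0).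
have es : s `^ beta = s `^ (beta - theta) * s `^ theta.
  by rewrite -powRD ?(gt_eqF s0) ?implybT// subrK.
set q := (1 - r) `^ theta.
have -> : 2 * s `^ (beta - theta) * (s `^ theta * q) = s `^ beta * (2 * q).
  by rewrite es; ring.
rewrite -[X in X - _]mulr1 -mulrBr ler_pM2l ?powR_gt0// /q {q}.
have p1 : 1 - r <= (1 - r) `^ theta.
  have [->|q] := eqVneq (1 - r) 0; first exact: powR_ge0.
  by apply: ger1_powR => //; rewrite lt0r q q0 /= gerBl.
have p2 : r ^+ 2 <= r `^ beta.
  have [->|q] := eqVneq r 0; first by rewrite expr0n /= powR_ge0.
  by rewrite -powR_mulrn//; apply: ger_powR => //; rewrite lt0r q r0.
nra.
Qed.

Definition trunc_pow beta N n : R := (minn n N)%:R `^ beta.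

(** The three inequalities between [a], [b] and [p] are what is known of
    [a = |l|], [b = |j|], [p = |j + l|] when [|l| <= |j|].  The constant [8] is
    the factor [2] of [powR_holder] times [2^(beta - theta) <= 4], which appears
    because [min p N] can be as large as [2 min b N]. *)
Lemma trunc_pow_dist beta theta N a b p : 0 < theta <= 1 -> theta <= beta <= 2 ->
  (a <= b)%N -> (p <= a + b)%N -> (b <= a + p)%N ->
  `|trunc_pow beta N p - trunc_pow beta N b| <=
  8 * (minn b N)%:R `^ (beta - theta) * (minn a N)%:R `^ theta.
Proof.
move=> ht hb ab pab bap; have /andP[t0 t1] := ht; have /andP[b0 b2] := hb.
have key m q : (q <= m)%N -> (m <= 2 * minn b N)%N -> (m - q <= minn a N)%N ->
   m%:R `^ beta - q%:R `^ beta <=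
     8 * (minn b N)%:R `^ (beta - theta) * (minn a N)%:R `^ theta :> R.
  move=> qm mb mq.
  have := @powR_holder _ _ m%:R q%:R ht hb; rewrite ler0n ler_nat qm => /(_ isT).
  move=> /le_trans; apply.
  apply: ler_pM; rewrite ?mulr_ge0 ?powR_ge0//; last first.
    by rewrite -natrB//; apply: ge0_ler_powR; rewrite ?nnegrE ?ler_nat// ltW.
  have -> : 8 = 2 * 4 :> R by ring.
  rewrite -mulrA ler_pM2l//.
  have : m%:R `^ (beta - theta) <= (2 * (minn b N)%:R) `^ (beta - theta) :> R.
    apply: ge0_ler_powR; rewrite ?nnegrE ?subr_ge0 ?mulr_ge0//.
    by rewrite -natrM ler_nat.
  move=> /le_trans; apply; rewrite powRM// ler_wpM2r ?powR_ge0//.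
  have -> : 4 = 2 `^ 2 :> R by rewrite powR_mulrn// expr2; ring.
  by apply: ler_powR; [lra|lra].
rewrite /trunc_pow; case: (leqP p b) => pb.
  rewrite distrC ger0_norm; first by apply: key; lia.
  by rewrite subr_ge0; apply: ge0_ler_powR; rewrite ?nnegrE ?ler_nat//; [lra|lia].
rewrite ger0_norm; first by apply: key; lia.
by rewrite subr_ge0; apply: ge0_ler_powR; rewrite ?nnegrE ?ler_nat//; [lra|lia].
Qed.

(** The increment from [b] to [p] contributes the factor [8] of
    [trunc_pow_dist], and the remaining value at [a] a factor [1]; hence
    [81 = (8 + 1)^2]. *)
Lemma trunc_pow_diff2 beta delta N a b p :
  0 < delta <= beta -> beta + delta <= 2 ->
  (a <= b)%N -> (p <= a + b)%N -> (b <= a + p)%N ->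
  (trunc_pow beta N p - trunc_pow beta N b - trunc_pow beta N a) ^+ 2 <=
  81 * ((minn b N)%:R `^ (beta - delta) * (minn a (minn b N))%:R `^ (beta + delta)).
Proof.
move=> /andP[d0 db] bd2 ab pab bap.
pose theta := (beta + delta) / 2.
have ht : 0 < theta <= 1 by rewrite /theta; lra.
have hb : theta <= beta <= 2 by rewrite /theta; lra.
have e1 : beta - delta = (beta - theta) * 2%:R by rewrite /theta; lra.
have e2 : beta + delta = theta * 2%:R by rewrite /theta; lra.
clearbody theta.
have h := trunc_pow_dist N ht hb ab pab bap.
have -> : minn a (minn b N) = minn a N by lia.
rewrite e1 e2 !powRrM !powR_mulrn ?powR_ge0//.
have h2 : trunc_pow beta N a <= (minn b N)%:R `^ (beta - theta) * (minn a N)%:R `^ theta.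
  have -> : trunc_pow beta N a = (minn a N)%:R `^ (beta - theta) * (minn a N)%:R `^ theta.
    rewrite -powRD ?subrK//; apply/implyP; lra.
  rewrite ler_wpM2r ?powR_ge0//.
  by apply: ge0_ler_powR; rewrite ?nnegrE ?ler_nat//; [lra|lia].
have h3 : 0 <= trunc_pow beta N a by exact: powR_ge0.
rewrite -exprMn.
set P := _ * _ `^ theta in h2 *; rewrite -mulrA -/P in h.
have -> : 81 * P ^+ 2 = (9 * P) ^+ 2 by ring.
move: h; rewrite ler_norml => /andP[h4 h5].
by rewrite -subr_ge0 subr_sqr mulr_ge0//; lra.
Qed.

End RealPowers.

(** * Sums over the integers *)

Section Sums.
Local Open Scope classical_set_scope.
Local Open Scope ereal_scope.
Variable R : realType.

Lemma esum_int (f : int -> \bar R) : (forall j, 0 <= f j) ->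
  \esum_(j in [set: int]) f j =
    \sum_(n <oo) f (Posz n) + \sum_(n <oo) f (Negz n).
Proof.
move=> f0; rewrite (esumID (range Posz))//; congr (_ + _).
  rewrite setTI esum_image// ?nneseries_esumT//.
  by move=> m n _ _ [].
have -> : [set: int] `&` ~` range Posz = range Negz.
  rewrite setTI; apply/seteqP; split=> [[n|n]|_ [n _ <-]] /=.
  - by move=> h; exfalso; apply: h; exists n.
  - by move=> _; exists n.
  - by move=> [m _].
rewrite esum_image// ?nneseries_esumT//.
by move=> m n _ _ [].
Qed.

(** Each nonzero absolute value is taken twice, hence the factor [2]. *)
Lemma esum_absz_le (f : nat -> R) (B : R) : (forall n, 0 <= f n)%R ->
  (forall K, \sum_(n < K.+1) f n <= B)%R ->
  \esum_(j in [set: int]) (f `|j|%N)%:E <= (2 * B)%:E.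
Proof.
move=> f0 hB; rewrite esum_int; last by move=> j; rewrite lee_fin.
rewrite mulrDl !mul1r EFinD; apply: leeD.
  apply: lime_le; first by apply: is_cvg_nneseries => n _ _; rewrite lee_fin.
  apply: nearW => -[|K] /=.
    by rewrite big_geq// lee_fin (le_trans _ (hB 0%N))// sumr_ge0.
  by rewrite sumEFin lee_fin big_mkord.
apply: lime_le; first by apply: is_cvg_nneseries => n _ _; rewrite lee_fin.
apply: nearW => K /=; rewrite sumEFin lee_fin big_mkord.
by apply: le_trans (hB K); rewrite big_ord_recl /= lerDr.
Qed.

Lemma esum_absz_ge (f : nat -> R) K : (forall n, 0 <= f n)%R ->
  (\sum_(n < K) f n)%:E <= \esum_(j in [set: int]) (f `|j|%N)%:E.
Proof.
move=> f0; rewrite esum_int; last by move=> j; rewrite lee_fin.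
rewrite -[leLHS]adde0; apply: leeD; last first.
  by apply: nneseries_ge0 => n _ _; rewrite lee_fin.
rewrite -sumEFin -(big_mkord xpredT (fun n => (f n)%:E)).
by apply: nneseries_lim_ge => n _; rewrite lee_fin.
Qed.

Lemma esumZ_le (T : choiceType) (D : set T) (c : R) (f : T -> R) :
  (0 <= c)%R -> (forall t, 0 <= f t)%R ->
  \esum_(t in D) (c * f t)%:E <= c%:E * \esum_(t in D) (f t)%:E.
Proof.
move=> c0 f0; apply: ge_ereal_sup => _ [X [finX XD] <-].
under eq_fsbigr do rewrite EFinM.
rewrite -ge0_mule_fsumr; last by move=> t; rewrite lee_fin.
rewrite lee_wpmul2l// ?lee_fin//.
by apply: ereal_sup_ubound; exists X.
Qed.

Lemma esum_prod_sym (T : choiceType) (f : T -> T -> R) :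
  (forall s t, 0 <= f s t)%R ->
  \esum_(p in [set: T * T]) (f p.1 p.2 + f p.2 p.1)%:E =
  2%:E * \esum_(s in [set: T]) \esum_(t in [set: T]) (f s t)%:E.
Proof.
move=> f0; under eq_esum do rewrite EFinD.
rewrite esumD; [|by move=> *; rewrite lee_fin..].
rewrite -[X in _ + X](reindex_esum [set: T * T] [set: T * T]
  (fun p => (p.2, p.1)) (fun p => (f p.1 p.2)%:E)); last first.
  split=> //; first by move=> [a b] [a' b'] _ _ /= [-> ->].
  by move=> [a b] _; exists (b, a).
rewrite (esum_esum (J := fun=> [set: T]) (a := fun s t => (f s t)%:E)); last first.
  by move=> *; rewrite lee_fin.
have -> : [set: T] `*`` (fun=> [set: T]) = [set: T * T].
  by apply/seteqP; split=> // -[a b].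
rewrite mule_natl mule2n//.
Qed.

Lemma harmonic_unbounded (B : R) : exists N, (B < \sum_(n < N) n.+1%:R^-1)%R.
Proof.
apply/not_existsP => hB; apply: (@dvg_harmonic R).
apply: nondecreasing_is_cvgn.
  apply: nondecreasing_series => n _ _; exact: harmonic_ge0.
exists B => _ [N _ <-]; rewrite leNgt; apply/negP.
by rewrite /series /= big_mkord; exact: hB.
Qed.

End Sums.

(** * The test functions *)

(** Subtracting the constant [N^beta] makes the support finite and leaves all
    differences unchanged. *)
Definition extremal (R : realType) (beta : R) (N : nat) (x : int) : R :=
  trunc_pow beta N `|x|%N - N%:R `^ beta.

Lemma extremal_compact (R : realType) (beta : R) (N : nat) :
  compactly_supported (extremal beta N).
Proof.
have fI : finite_set `I_N by exact: finite_II.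
apply: (@sub_finite_set _ _ (Posz @` `I_N `|` Negz @` `I_N)%classic); last first.
  by rewrite finite_setU; split; exact: finite_image.
move=> x /= hx; have xN : (`|x| < N)%N.
  rewrite ltnNge; apply: contraNN hx => Nx.
  by rewrite /extremal /trunc_pow (minn_idPr Nx) subrr.
case: x xN {hx} => n nN; [left|right]; exists n => //=; lia.
Qed.

(** * Comparing the two operators on the test functions *)

Section Extremal.
Variables (R : realType) (c beta delta : R).
Hypotheses (c0 : 0 < c) (hdelta : 0 < delta <= beta) (hbeta : beta + delta <= 2).
Implicit Types (n a b N K : nat) (i j l : int).

Let delta0 : 0 < delta. Proof. by case/andP: hdelta. Qed.
Let beta0 : 0 < beta. Proof. by case/andP: hdelta => /lt_le_trans; apply. Qed.
Let bd0 : beta + delta != 0. Proof. by rewrite lt0r_neq0 ?addr_gt0. Qed.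
Let bd_ge0 : 0 <= beta - delta. Proof. by rewrite subr_ge0; case/andP: hdelta. Qed.

Definition radial_kernel n : R := c * n%:R `^ (- (1 + beta)).

Lemma power_kernelE j : power_kernel c beta j = radial_kernel `|j|%N.
Proof.
rewrite /power_kernel /radial_kernel natr_absz intr_norm.
have [->|j0] := eqVneq j 0; last by rewrite powRN.
by rewrite normr0 powR0 ?mulr0// oppr_eq0 lt0r_neq0// addr_gt0.
Qed.

Lemma radial_kernel_ge0 n : 0 <= radial_kernel n.
Proof. by rewrite mulr_ge0 ?powR_ge0// ltW. Qed.

Lemma trunc_pow_ge0 N n : 0 <= trunc_pow beta N n :> R.
Proof. exact: powR_ge0. Qed.

Lemma trunc_pow0 N : trunc_pow beta N 0 = 0 :> R.
Proof. by rewrite /trunc_pow min0n powR0// lt0r_neq0. Qed.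

Definition Lsum N : \bar R :=
  \esum_(j in [set: int]) (radial_kernel `|j|%N * trunc_pow beta N `|j|%N)%:E.

Lemma Lop_extremal N : Lop (power_kernel c beta) (extremal beta N) 0 = Lsum N.
Proof.
rewrite /Lop /zsum.
set f := (fun j => _); have fE j : f j = radial_kernel `|j|%N * trunc_pow beta N `|j|%N.
  rewrite /f power_kernelE add0r /extremal absz0 trunc_pow0; congr (_ * _); ring.
have f0 j : 0 <= f j by rewrite fE mulr_ge0 ?radial_kernel_ge0 ?trunc_pow_ge0.
rewrite (_ : \esum_(j in [set: int]) (f^\- j)%:E = 0)%E; last first.
  by apply: esum1 => j _; rewrite /funrneg /= max_r// oppr_le0.
rewrite sube0; apply: eq_esum => j _.
by rewrite /funrpos /= max_l// fE.
Qed.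

Lemma radial_sum_le K M :
  \sum_(n < K.+1) radial_kernel n * (minn n M)%:R `^ (beta + delta)
   <= c * (2 / delta + beta^-1) * M%:R `^ delta.
Proof.
have d1 : 0 < delta <= 1.
  apply/andP; split=> //; move: hbeta; case/andP: hdelta => h1 h2 h3; lra.
rewrite -mulrA; under eq_bigr do rewrite /radial_kernel -mulrA.
by rewrite -mulr_sumr ler_pM2l// sum_powR_minn_le.
Qed.

(** Finiteness matters: the final contradiction divides [A^2 <= C d A] by [A].
    The case [M = 1] of [radial_sum_le] says that the kernel is summable. *)
Lemma Lsum_fin N : Lsum N \is a fin_num.
Proof.
rewrite ge0_fin_numE; last first.
  by apply: esum_ge0 => j _; rewrite lee_fin mulr_ge0 ?radial_kernel_ge0 ?trunc_pow_ge0.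
apply: le_lt_trans (ltry (2 * (N%:R `^ beta * (c * (2 / delta + beta^-1))))).
apply: (esum_absz_le (f := fun n => radial_kernel n * trunc_pow beta N n)).
  by move=> n; rewrite mulr_ge0 ?radial_kernel_ge0 ?trunc_pow_ge0.
move=> K; have := radial_sum_le K 1; rewrite powR1 mulr1 => h.
apply: le_trans (ler_wpM2l (powR_ge0 N%:R beta) h).
rewrite mulr_sumr; apply: ler_sum => n _.
rewrite mulrCA ler_wpM2l ?radial_kernel_ge0//.
case: (nat_of_ord n) => [|m].
  by rewrite trunc_pow0 mulr_ge0 ?powR_ge0.
rewrite (minn_idPr _)// powR1 mulr1 /trunc_pow.
by apply: ge0_ler_powR; rewrite ?nnegrE ?ler_nat ?geq_minr// ltW.
Qed.

(** The exponent of [w] is chosen to make [k n * w n = c / n] when [1 <= n <= N]. *)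
Lemma Lsum_ge N : ((c * \sum_(n < N) n.+1%:R^-1)%:E <= Lsum N)%E.
Proof.
pose f n := radial_kernel n * trunc_pow beta N n.
apply: le_trans (esum_absz_ge (f := f) N.+1 _); rewrite {}/f; last first.
  by move=> n; rewrite mulr_ge0 ?radial_kernel_ge0 ?trunc_pow_ge0.
rewrite lee_fin big_ord_recl /= trunc_pow0 mulr0 add0r mulr_sumr.
apply: ler_sum => n _; rewrite /trunc_pow /radial_kernel /bump leq0n add1n.
rewrite (minn_idPl _)// -mulrA -powRD ?pnatr_eq0 ?implybT//.
have -> : - (1 + beta) + beta = -1 by ring.
by rewrite powR_inv1.
Qed.

(** Here [a] is the larger of the two distances.  The product is defined for all
    [a] and [b] so that the sum over [b] can be extended to the whole line. *)
Definition Gamma2_majorant N a b : R :=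
  81 * (radial_kernel a * (minn a N)%:R `^ (beta - delta)) *
    (radial_kernel b * (minn b (minn a N))%:R `^ (beta + delta)).

Lemma Gamma2_majorant_ge0 N a b : 0 <= Gamma2_majorant N a b.
Proof.
apply: mulr_ge0; last by rewrite mulr_ge0 ?radial_kernel_ge0 ?powR_ge0.
by rewrite mulr_ge0// mulr_ge0 ?radial_kernel_ge0 ?powR_ge0.
Qed.

(** Adding the majorant with exchanged arguments covers both orders of [|j|] and
    [|l|]. *)
Lemma second_difference_le N j l :
  power_kernel c beta j * power_kernel c beta l *
    (extremal beta N (0 + j + l) - extremal beta N (0 + j) - extremal beta N (0 + l)
       + extremal beta N 0) ^+ 2 <=
  Gamma2_majorant N `|j|%N `|l|%N + Gamma2_majorant N `|l|%N `|j|%N.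
Proof.
rewrite !power_kernelE !add0r.
set D := _ + _; have -> : D = trunc_pow beta N `|(j + l)%R|%N
    - trunc_pow beta N `|j|%N - trunc_pow beta N `|l|%N.
  by rewrite /D /extremal absz0 trunc_pow0; ring.
have key a b p : (a <= b)%N -> (p <= a + b)%N -> (b <= a + p)%N ->
    radial_kernel b * radial_kernel a *
      (trunc_pow beta N p - trunc_pow beta N b - trunc_pow beta N a) ^+ 2
    <= Gamma2_majorant N b a.
  move=> ab pab bap; have := trunc_pow_diff2 N hdelta hbeta ab pab bap.
  move=> /(ler_wpM2l (mulr_ge0 (radial_kernel_ge0 b) (radial_kernel_ge0 a))).
  move=> /le_trans; apply; rewrite /Gamma2_majorant.
  by rewrite le_eqVlt; apply/orP; left; apply/eqP; ring.
case: (leqP `|l|%N `|j|%N) => h.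
  rewrite -[leLHS]addr0 lerD ?Gamma2_majorant_ge0//; apply: key => //; lia.
rewrite -[leLHS]add0r lerD ?Gamma2_majorant_ge0// addrAC (mulrC (radial_kernel _)).
apply: key; lia.
Qed.

(** The sum over the shorter jump turns [M^(beta - delta)] into
    [M^(beta - delta) * M^delta = w j], so the remaining sum is the one that
    defines [L w (0)].  The constant is [81] from [trunc_pow_diff2] times
    [2 * 2 / 4]: two signs of the shorter jump, two orders of the jumps, and the
    factor of [Gamma2]. *)
Lemma Gamma2_extremal_le N :
  (Gamma2 (power_kernel c beta) (extremal beta N) 0 <=
     (81 * c * (2 / delta + beta^-1))%:E * Lsum N)%E.
Proof.
set C := 2 / delta + beta^-1.
have C0 : 0 <= C by rewrite addr_ge0 ?divr_ge0 ?invr_ge0// ltW.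
have inner a : (\esum_(l in [set: int]) (Gamma2_majorant N a `|l|%N)%:E <=
    (162 * c * C * (radial_kernel a * trunc_pow beta N a))%:E)%E.
  pose M := minn a N; pose u := 81 * (radial_kernel a * M%:R `^ (beta - delta)).
  have u0 : 0 <= u by rewrite mulr_ge0// mulr_ge0 ?radial_kernel_ge0 ?powR_ge0.
  have -> : 162 * c * C * (radial_kernel a * trunc_pow beta N a) =
      2 * (u * (c * C * M%:R `^ delta)).
    have -> : trunc_pow beta N a = M%:R `^ (beta - delta) * M%:R `^ delta.
      by rewrite -powRD subrK ?(gt_eqF beta0).
    by rewrite /u; ring.
  apply: esum_absz_le => [n|K]; first exact: Gamma2_majorant_ge0.
  by rewrite -mulr_sumr ler_wpM2l// radial_sum_le.
rewrite /Gamma2.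
apply: (@le_trans _ _ ((4^-1)%:E * (2%:E * ((162 * c * C)%:E * Lsum N)))%E).
  rewrite lee_wpmul2l ?lee_fin ?invr_ge0//.
  apply: (@le_trans _ _ (\esum_(p in [set: int * int])
      (Gamma2_majorant N `|p.1|%N `|p.2|%N + Gamma2_majorant N `|p.2|%N `|p.1|%N)%:E)%E).
    by apply: le_esum => p _; rewrite lee_fin; exact: second_difference_le.
  rewrite (@esum_prod_sym _ _
    (fun j l : int => Gamma2_majorant N `|j|%N `|l|%N)); last first.
    by move=> *; exact: Gamma2_majorant_ge0.
  rewrite lee_wpmul2l ?lee_fin//.
  apply: le_trans (esumZ_le _ _ _); first by apply: le_esum => j _; exact: inner.
    by rewrite !mulr_ge0// ltW.
  by move=> j; rewrite mulr_ge0 ?radial_kernel_ge0 ?trunc_pow_ge0.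
rewrite !muleA -!EFinM le_eqVlt; apply/orP; left; apply/eqP; congr (_%:E * _)%E.
by field.
Qed.

End Extremal.

Theorem theorem3p2 (R : realType) (c beta : R)
    (hc : 0 < c) (hbeta : 0 < beta < 2) :
  ~ exists d : R, 0 < d /\
      forall v : int -> R, compactly_supported v ->
        (Gamma2 (power_kernel c beta) v 0 >=
           (d^-1)%:E * Lop (power_kernel c beta) v 0 ^+ 2)%E.
Proof.
move=> [d [d0 CD]].
pose delta := Num.min beta (2 - beta).
have hd : 0 < delta <= beta.
  by rewrite /delta lt_min ge_min lexx; case/andP: hbeta => *; lra.
have hbd : beta + delta <= 2.
  by rewrite -lerBrDl /delta ge_min lexx orbT.
pose C := 81 * c * (2 / delta + beta^-1).
(* [N] is chosen so large that [L v (0)] exceeds [d * C]. *)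
have [N HN] := harmonic_unbounded (d * C / c).
have := CD _ (extremal_compact beta N).
rewrite (Lop_extremal _ hd)// => /le_trans /(_ (Gamma2_extremal_le hc hd hbd N)).
have := Lsum_ge hc hd N.
rewrite -(fineK (Lsum_fin hc hd hbd N)).
set A := fine _; rewrite -/C -EFin_expe -!EFinM !lee_fin => h1 h2.
have C0 : 0 < C.
  case/andP: hd hbeta => ? ? /andP[? ?].
  by rewrite !mulr_gt0// addr_gt0 ?divr_gt0 ?invr_gt0.
have h3 : d * C < A.
  by apply: lt_le_trans h1; rewrite -ltr_pdivrMl// mulrC.
have A0 : 0 < A by apply: le_lt_trans h3; rewrite mulr_ge0// ltW.
move: h2; rewrite expr2 mulrA ler_pM2r// ler_pdivrMl//.
by move=> /(lt_le_trans h3); rewrite ltxx.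
Qed.
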